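(* Let $A,B,C,D$ be the weight functions of the stochastic $\Gamma$-$\Gamma$, $\Delta$-$\Delta$, $\Delta$-$\Gamma$ and $\Gamma$-$\Delta$ vertices respectively, all with spectral parameters $z_i,z_j$, and let $K$ be either of the two cap weights: the reflecting one ($K(+,+)=K(-,-)=1$, $K(+,-)=K(-,+)=0$) or the absorbing-and-emitting one ($K(+,-)=K(-,+)=1$, $K(+,+)=K(-,-)=0$). For spins $\epsilon_1,\epsilon_2,\epsilon_3,\epsilon_4\in\{+,-\}$ put $$Z(I_1(\epsilon_1,\epsilon_2,\epsilon_3,\epsilon_4))=\sum D(\epsilon_3,\epsilon_2,p,r)\,A(p,\epsilon_1,\delta_1,s)\,B(\epsilon_4,r,t,\delta_4)\,C(t,s,\delta_2,\delta_3)\,K(\delta_1,\delta_2)\,K(\delta_3,\delta_4),$$ where the sum is over all $p,r,s,t,\delta_1,\delta_2,\delta_3,\delta_4\in\{+,-\}$, and $$Z(I_2(\epsilon_1,\epsilon_2,\epsilon_3,\epsilon_4))=K(\epsilon_1,\epsilon_2)K(\epsilon_3,\epsilon_4).$$ Then for all $\epsilon_1,\epsilon_2,\epsilon_3,\epsilon_4\in\{+,-\}$ and for both choices of $K$, $$Z(I_1(\epsilon_1,\epsilon_2,\epsilon_3,\epsilon_4))=\frac{(qz_iz_j-1)\bigl(1-(q+1)(z_i+z_j)+(q^2+q+1)z_iz_j\bigr)}{q\bigl(z_i+z_j-(q+1)z_iz_j\bigr)^2}\,Z(I_2(\epsilon_1,\epsilon_2,\epsilon_3,\epsilon_4)).$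$
   Context: Parameters: $q,z_i,z_j$ are indeterminates (equivalently, generic complex numbers for which every denominator is nonzero); $z_i'=q+1-\frac1{z_i}$, $z_j'=q+1-\frac1{z_j}$. R-vertices with spectral parameters $z_i,z_j$: the weight is a function of the spins (bottom-left, top-left, top-right, bottom-right) in $\{+,-\}$; configurations not listed have weight $0$. In all four types $(+,+,+,+)\mapsto 1$ and $(-,-,-,-)\mapsto 1$; moreover: - $\Gamma$-$\Gamma$, with $P=1-(q+1)z_j+qz_iz_j$: $(+,-,+,-)\mapsto\frac{z_i-z_j}{P}$, $(-,+,-,+)\mapsto\frac{q(z_i-z_j)}{P}$, $(-,+,+,-)\mapsto\frac{(1-qz_i)(1-z_j)}{P}$, $(+,-,-,+)\mapsto\frac{(1-z_i)(1-qz_j)}{P}$. - $\Delta$-$\Gamma$: $(+,-,+,-)\mapsto\frac{z_i'+qz_j-(q+1)z_i'z_j}{1-z_i'z_j}$, $(-,+,-,+)\mapsto\frac{q^{-1}z_i'+z_j-(1+q^{-1})z_i'z_j}{1-z_i'z_j}$, $(-,-,+,+)\mapsto\frac{(1-z_i')(1-qz_j)}{1-z_i'z_j}$, $(+,+,-,-)\mapsto\frac{(1-q^{-1}z_i')(1-z_j)}{1-z_i'z_j}$. - $\Delta$-$\Delta$, with $Q=q-(q+1)z_i'+z_i'z_j'$: $(+,-,+,-)\mapsto\frac{z_j'-z_i'}{Q}$, $(-,+,-,+)\mapsto\frac{q(z_j'-z_i')}{Q}$, $(-,+,+,-)\mapsto\frac{(1-z_i')(q-z_j')}{Q}$, $(+,-,-,+)\mapsto\frac{(1-z_j')(q-z_i')}{Q}$.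 - $\Gamma$-$\Delta$: $(+,-,+,-)\mapsto\frac{qz_i+z_j'-(1+q)}{z_iz_j'-1}$, $(-,+,-,+)\mapsto\frac{qz_i+z_j'-(1+q)}{q(z_iz_j'-1)}$, $(-,-,+,+)\mapsto\frac{(1-qz_i)(1-z_j')}{z_iz_j'-1}$, $(+,+,-,-)\mapsto\frac{(1-z_i)(q-z_j')}{q(z_iz_j'-1)}$. A cap has weight $K(x,y)$ where $x$ is its top spin and $y$ its bottom spin. *)

(* Defs.v *)
From HB Require Import structures.
From mathcomp Require Import all_boot all_order all_algebra.

Set Implicit Arguments.
Unset Strict Implicit.
Unset Printing Implicit Defensive.

Import GRing.Theory.
Local Open Scope ring_scope.

(* A spin is a boolean: true is the spin +, false is the spin -. *)
Notation spin := bool (only parsing).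
Notation sp := true (only parsing).
Notation sm := false (only parsing).

(* Arguments, in order: bottom-left, top-left, top-right, bottom-right. *)
Definition vertex_weight (F : fieldType) := spin -> spin -> spin -> spin -> F.

(* Arguments, in order: top, bottom. *)
Definition cap_weight (F : fieldType) := spin -> spin -> F.

(* The parameter z' attached to z in the rows of type Delta. *)
Definition dual_param (F : fieldType) (q z : F) : F := q + 1 - z^-1.

Definition GG_den (F : fieldType) (q zi zj : F) : F :=
  1 - (q + 1) * zj + q * zi * zj.

Definition DD_den (F : fieldType) (q zi zj : F) : F :=
  let zi' := dual_param q zi in
  let zj' := dual_param q zj in
  q - (q + 1) * zi' + zi' * zj'.

Definition DG_den (F : fieldType) (q zi zj : F) : F :=
  1 - dual_param q zi * zj.

Definition GD_den (F : fieldType) (q zi zj : F) : F :=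
  zi * dual_param q zj - 1.

Definition weight_GG (F : fieldType) (q zi zj : F) : vertex_weight F :=
  fun bl tl tr br =>
  let P := GG_den q zi zj in
  match bl, tl, tr, br with
  | sp, sp, sp, sp => 1
  | sm, sm, sm, sm => 1
  | sp, sm, sp, sm => (zi - zj) / P
  | sm, sp, sm, sp => q * (zi - zj) / P
  | sm, sp, sp, sm => (1 - q * zi) * (1 - zj) / P
  | sp, sm, sm, sp => (1 - zi) * (1 - q * zj) / P
  | _, _, _, _ => 0
  end.

Definition weight_DG (F : fieldType) (q zi zj : F) : vertex_weight F :=
  fun bl tl tr br =>
  let zi' := dual_param q zi in
  let d := DG_den q zi zj in
  match bl, tl, tr, br with
  | sp, sp, sp, sp => 1
  | sm, sm, sm, sm => 1
  | sp, sm, sp, sm => (zi' + q * zj - (q + 1) * zi' * zj) / d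
  | sm, sp, sm, sp => (q^-1 * zi' + zj - (1 + q^-1) * zi' * zj) / d
  | sm, sm, sp, sp => (1 - zi') * (1 - q * zj) / d
  | sp, sp, sm, sm => (1 - q^-1 * zi') * (1 - zj) / d
  | _, _, _, _ => 0
  end.

Definition weight_DD (F : fieldType) (q zi zj : F) : vertex_weight F :=
  fun bl tl tr br =>
  let zi' := dual_param q zi in
  let zj' := dual_param q zj in
  let Q := DD_den q zi zj in
  match bl, tl, tr, br with
  | sp, sp, sp, sp => 1
  | sm, sm, sm, sm => 1
  | sp, sm, sp, sm => (zj' - zi') / Q
  | sm, sp, sm, sp => q * (zj' - zi') / Q
  | sm, sp, sp, sm => (1 - zi') * (q - zj') / Q
  | sp, sm, sm, sp => (1 - zj') * (q - zi') / Q
  | _, _, _, _ => 0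
  end.

Definition weight_GD (F : fieldType) (q zi zj : F) : vertex_weight F :=
  fun bl tl tr br =>
  let zj' := dual_param q zj in
  let d := GD_den q zi zj in
  match bl, tl, tr, br with
  | sp, sp, sp, sp => 1
  | sm, sm, sm, sm => 1
  | sp, sm, sp, sm => (q * zi + zj' - (1 + q)) / d
  | sm, sp, sm, sp => (q * zi + zj' - (1 + q)) / (q * d)
  | sm, sm, sp, sp => (1 - q * zi) * (1 - zj') / d
  | sp, sp, sm, sm => (1 - zi) * (q - zj') / (q * d)
  | _, _, _, _ => 0
  end.

Definition reflecting_cap (F : fieldType) : cap_weight F :=
  fun x y =>
  match x, y with
  | sp, sp | sm, sm => 1
  | sp, sm | sm, sp => 0
  end.

Definition absorbing_emitting_cap (F : fieldType) : cap_weight F :=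
  fun x y =>
  match x, y with
  | sp, sm | sm, sp => 1
  | sp, sp | sm, sm => 0
  end.

Definition Z_I1 (F : fieldType) (q zi zj : F) (K : cap_weight F)
    (e1 e2 e3 e4 : spin) : F :=
  let A := weight_GG q zi zj in
  let B := weight_DD q zi zj in
  let C := weight_DG q zi zj in
  let D := weight_GD q zi zj in
  \sum_(p : spin) \sum_(r : spin) \sum_(s : spin) \sum_(t : spin)
  \sum_(d1 : spin) \sum_(d2 : spin) \sum_(d3 : spin) \sum_(d4 : spin)
    D e3 e2 p r * A p e1 d1 s * B e4 r t d4 * C t s d2 d3 * K d1 d2 * K d3 d4.

Definition Z_I2 (F : fieldType) (K : cap_weight F) (e1 e2 e3 e4 : spin) : F :=
  K e1 e2 * K e3 e4.

(* Main.v *)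
(* Summing out the spins vertex by vertex, from left to right, turns Z(I_1) into
   a composite of four sparse operators, one per vertex, applied to the product
   of the two caps: by the ice rule each operator produces at most two terms.
   In terms of z_i, z_j the denominators of the four vertices are, up to
   monomials and signs,
     1 - (q+1) z_j + q z_i z_j,   1 - (q+1) z_i + q z_i z_j,
   and twice z_i + z_j - (q+1) z_i z_j; what remains, for each boundary
   condition and each cap, is a rational identity in q, z_i, z_j in which the
   first two denominators cancel. *)
Require Import Defs.
From mathcomp Require Import all_boot all_order all_algebra ring.
Import GRing.Theory.
Local Open Scope ring_scope.

(** Ice rule of a vertex whose two rows have the same type: the unordered pair of spins on the left
    reappears on the right. *)
Definition parallel_vertex {F : fieldType} (a b c d : F) : vertex_weight F :=
  fun bl tl tr br =>
  match bl, tl, tr, br with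
  | true, true, true, true | false, false, false, false => 1
  | true, false, true, false => a
  | false, true, false, true => b
  | false, true, true, false => c
  | true, false, false, true => d
  | _, _, _, _ => 0
  end.

(** Ice rule for rows of opposite types: the difference [bl - tl] of the left spins equals
    [tr - br], so equal spins may flip together. *)
Definition antiparallel_vertex {F : fieldType} (a b c d : F) :
    vertex_weight F :=
  fun bl tl tr br =>
  match bl, tl, tr, br with
  | true, true, true, true | false, false, false, false => 1
  | true, false, true, false => a
  | false, true, false, true => b
  | false, false, true, true => c
  | true, true, false, false => d
  | _, _, _, _ => 0
  end.

(** Here [f] is the partition function of everything to the right of the vertex. *)
Definition transfer {F : fieldType} (W : vertex_weight F)
    (f : bool -> bool -> F) (bl tl : bool) : F :=
  \sum_(tr : bool) \sum_(br : bool) W bl tl tr br * f tr br.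

(** Congruence for [under]: weights are only known to agree pointwise, and the nested continuation
    must be rewritten under its binders. *)
Lemma eq_transfer (F : fieldType) (V W : vertex_weight F)
    (f g : bool -> bool -> F) :
  (forall bl tl tr br, V bl tl tr br = W bl tl tr br) ->
  (forall x y, f x y = g x y) -> forall bl tl,
  transfer V f bl tl = transfer W g bl tl.
Proof.
move=> eqVW eqfg bl tl.
by apply: eq_bigr => tr _; apply: eq_bigr => br _; rewrite eqVW eqfg.
Qed.

Lemma transfer_parallel (F : fieldType) (a b c d : F) f bl tl :
  transfer (parallel_vertex a b c d) f bl tl =
  match bl, tl with
  | true, true => f true true
  | false, false => f false false
  | true, false => a * f true false + d * f false true
  | false, true => b * f false true + c * f true false
  end.
Proof.
rewrite /transfer !big_bool.
by case: bl; case: tl; rewrite /= !(mul0r, add0r, addr0, mul1r) // addrC.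
Qed.

Lemma transfer_antiparallel (F : fieldType) (a b c d : F) f bl tl :
  transfer (antiparallel_vertex a b c d) f bl tl =
  match bl, tl with
  | true, true => f true true + d * f false false
  | false, false => f false false + c * f true true
  | true, false => a * f true false
  | false, true => b * f false true
  end.
Proof.
rewrite /transfer !big_bool.
by case: bl; case: tl; rewrite /= !(mul0r, add0r, addr0, mul1r) // addrC.
Qed.

Lemma Z_I1_transfer (F : fieldType) (q zi zj : F) K e1 e2 e3 e4 :
  Z_I1 q zi zj K e1 e2 e3 e4 =
  transfer (weight_GD q zi zj) (fun p r =>
    transfer (weight_GG q zi zj) (fun d1 s =>
      transfer (weight_DD q zi zj) (fun t d4 =>
        transfer (weight_DG q zi zj) (fun d2 d3 => K d1 d2 * K d3 d4) t s)
      e4 r) p e1) e3 e2.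
Proof.
rewrite /Z_I1 /transfer.
apply: eq_bigr => p _; apply: eq_bigr => r _.
(* The sum over [d1] moves outside those over [s] and [t], since [d1] and [s] leave the same
   vertex. *)
under eq_bigr do rewrite exchange_big /=.
rewrite exchange_big big_distrr /=; apply: eq_bigr => d1 _.
rewrite big_distrr /=; apply: eq_bigr => s _.
rewrite !big_distrr /=; apply: eq_bigr => t _.
(* Likewise [d4] moves out to join [t]. *)
under eq_bigr do rewrite exchange_big /=.
rewrite exchange_big !big_distrr /=; apply: eq_bigr => d4 _.
rewrite !big_distrr /=; apply: eq_bigr => d2 _.
rewrite !big_distrr /=; apply: eq_bigr => d3 _.
by rewrite !mulrA.
Qed.

Lemma DD_denE (F : fieldType) (q zi zj : F) : zi != 0 -> zj != 0 ->
  DD_den q zi zj = (1 - (q + 1) * zi + q * zi * zj) / (zi * zj).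
Proof. by move=> hzi hzj; rewrite /DD_den /dual_param; field; apply/andP. Qed.

Lemma DG_denE (F : fieldType) (q zi zj : F) : zi != 0 ->
  DG_den q zi zj = (zi + zj - (q + 1) * zi * zj) / zi.
Proof. by move=> hzi; rewrite /DG_den /dual_param; field. Qed.

Lemma GD_denE (F : fieldType) (q zi zj : F) : zj != 0 ->
  GD_den q zi zj = - (zi + zj - (q + 1) * zi * zj) / zj.
Proof. by move=> hzj; rewrite /GD_den /dual_param; field. Qed.

Lemma weight_GGE (F : fieldType) (q zi zj : F) bl tl tr br :
  let P := 1 - (q + 1) * zj + q * zi * zj in
  weight_GG q zi zj bl tl tr br =
  parallel_vertex ((zi - zj) / P) (q * (zi - zj) / P)
    ((1 - q * zi) * (1 - zj) / P) ((1 - zi) * (1 - q * zj) / P) bl tl tr br.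
Proof. by case: bl; case: tl; case: tr; case: br. Qed.

(** With the primes cleared, this is the Gamma-Gamma vertex with [zi] and [zj] exchanged and its
    last two weights swapped. *)
Lemma weight_DDE (F : fieldType) (q zi zj : F) bl tl tr br :
  let Q := 1 - (q + 1) * zi + q * zi * zj in
  zi != 0 -> zj != 0 -> Q != 0 ->
  weight_DD q zi zj bl tl tr br =
  parallel_vertex ((zj - zi) / Q) (q * (zj - zi) / Q)
    ((1 - q * zi) * (1 - zj) / Q) ((1 - zi) * (1 - q * zj) / Q) bl tl tr br.
Proof.
move=> Q hzi hzj hQ; rewrite /weight_DD DD_denE // /dual_param -/Q.
case: bl; case: tl; case: tr; case: br => //=; field;
  by rewrite hQ hzi hzj.
Qed.

Lemma weight_DGE (F : fieldType) (q zi zj : F) bl tl tr br :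
  let N := zi + zj - (q + 1) * zi * zj in
  let x := (q + 1) * zi - 1 + q * zi * zj
           - (q + 1) * ((q + 1) * zi - 1) * zj in
  q != 0 -> zi != 0 -> N != 0 ->
  weight_DG q zi zj bl tl tr br =
  antiparallel_vertex (x / N) (x / (q * N))
    ((1 - q * zi) * (1 - q * zj) / N) ((1 - zi) * (1 - zj) / (q * N))
    bl tl tr br.
Proof.
move=> N x hq hzi hN; rewrite /weight_DG DG_denE // /dual_param -/N /x.
case: bl; case: tl; case: tr; case: br => //=; field;
  by rewrite hN ?hq hzi.
Qed.

(** The last two weights are opposite to those of [weight_DGE]. The first one times the second one
    there, [x / (q * N)], is the scalar of the theorem, because [x] expands to minus its long
    factor. *)
Lemma weight_GDE (F : fieldType) (q zi zj : F) bl tl tr br :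
  let N := zi + zj - (q + 1) * zi * zj in
  q != 0 -> zj != 0 -> N != 0 ->
  weight_GD q zi zj bl tl tr br =
  antiparallel_vertex ((1 - q * zi * zj) / N) ((1 - q * zi * zj) / (q * N))
    (- ((1 - q * zi) * (1 - q * zj) / N)) (- ((1 - zi) * (1 - zj) / (q * N)))
    bl tl tr br.
Proof.
move=> N hq hzj hN; rewrite /weight_GD GD_denE // /dual_param -/N.
case: bl; case: tl; case: tr; case: br => //=; field;
  by rewrite oppr_eq0 hN ?hq hzj.
Qed.

Theorem theorem2p2 (F : fieldType) (q zi zj : F)
    (hq : q != 0) (hzi : zi != 0) (hzj : zj != 0)
    (hGG : GG_den q zi zj != 0) (hDD : DD_den q zi zj != 0)
    (hDG : DG_den q zi zj != 0) (hGD : GD_den q zi zj != 0)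
    (hden : zi + zj - (q + 1) * zi * zj != 0)
    (K : cap_weight F)
    (hK : K = @reflecting_cap F \/ K = @absorbing_emitting_cap F)
    (e1 e2 e3 e4 : spin) :
  Z_I1 q zi zj K e1 e2 e3 e4 =
    (q * zi * zj - 1) *
      (1 - (q + 1) * (zi + zj) + (q ^+ 2 + q + 1) * zi * zj) /
      (q * (zi + zj - (q + 1) * zi * zj) ^+ 2) *
    Z_I2 K e1 e2 e3 e4.
Proof.
have hQ : 1 - (q + 1) * zi + q * zi * zj != 0.
  by move: hDD; rewrite DD_denE // mulf_eq0 negb_or => /andP[].
rewrite /GG_den in hGG.
rewrite Z_I1_transfer.
(* One level per vertex: its weight is put in normal form, then the continuation is entered. *)
under eq_transfer => [? ? ? ?|p r].
  rewrite weight_GDE //; over.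
  under eq_transfer => [? ? ? ?|d1 s].
    rewrite weight_GGE; over.
    under eq_transfer => [? ? ? ?|t d4].
      rewrite weight_DDE //; over.
      under eq_transfer => [? ? ? ?|d2 d3].
        rewrite weight_DGE //; over.
        over.
      over.
    over.
  over.
rewrite /Z_I2.
case: hK => ->; case: e1; case: e2; case: e3; case: e4.
all: rewrite !(transfer_antiparallel, transfer_parallel) /=.
all: rewrite ?(mul0r, mulr0, add0r, addr0, mul1r, mulr1) //.
all: by field; rewrite hden ?hq ?hQ ?hGG.
Qed.
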